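(* Let $\{X_\ell,F_\ell\}_{\ell=1}^{\infty}$ be an inverse sequence of compact metric spaces $X_\ell$ and upper semicontinuous set-valued functions $F_\ell:X_{\ell+1}\multimap X_\ell$. The following statements are equivalent. 1. The inverse limit $\varprojlim\{X_\ell,F_\ell\}_{\ell=1}^\infty$ (with set-valued bonding functions) does not have the fixed point property. 2. There is a sequence $(H_\ell)$ of upper semicontinuous functions $H_\ell:\star_{i=1}^{\ell+1}\Gamma(F_i^{-1})\multimap\star_{i=1}^{\ell}\Gamma(F_i^{-1})$ such that (a) for each positive integer $k$, for each $(x_1,x_2,\ldots,x_{k+3})\in\star_{i=1}^{k+2}\Gamma(F_i^{-1})$, and for each $(z_1,z_2,\ldots,z_{k+2})\in H_{k+1}(x_1,x_2,\ldots,x_{k+3})$, $(z_1,z_2,\ldots,z_{k+1})\in H_k(x_1,x_2,\ldots,x_{k+2})$; (b) for each positive integer $j$ and for each $\mathbf x=(x_1,x_2,x_3,\ldots)\in\varprojlim\{X_\ell,F_\ell\}_{\ell=1}^\infty$, $\lim_{k\to\infty}\operatorname{diam}(\mathcal H_{j,k}(\mathbf x))=0$, where for each positive integer $k>j$, $\mathcal H_{j,k}(\mathbf x)$ is the set of all points $(z_1,z_2,\ldots,z_{j+1})\in\star_{i=1}^{j}\Gamma(F_i^{-1})$ such that there is a point $(y_1,y_2,\ldots,y_{k+1})\in H_k(x_1,x_2,\ldots,x_{k+2})$ with $(y_1,\ldots,y_{j+1})=(z_1,\ldots,z_{j+1})$; (c) there is a positive integer $k$ such that $(x_1,x_2,\ldots,x_{k+1})\notin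 H_k(x_1,x_2,\ldots,x_{k+1},x_{k+2})$ for each $(x_1,x_2,\ldots,x_{k+1},x_{k+2})\in\star_{i=1}^{k+1}\Gamma(F_i^{-1})$.
   Context: A space has the fixed point property if every continuous function from it to itself has a fixed point. For compact metric spaces $X,Y$, a set-valued function $F:X\multimap Y$ is a function from $X$ to the set $2^Y$ of non-empty closed subsets of $Y$; it is upper semicontinuous if for each open $V\subseteq Y$ the set $\{x\in X\mid F(x)\subseteq V\}$ is open in $X$. The inverse limit $\varprojlim\{X_\ell,F_\ell\}_{\ell=1}^\infty$ with set-valued bonding functions is the subspace of $\prod_{\ell=1}^\infty X_\ell$ of all $(x_1,x_2,\ldots)$ with $x_\ell\in F_\ell(x_{\ell+1})$ for each $\ell$. For $m\le n$, the Mahavier product is $\star_{i=m}^n\Gamma(F_i^{-1})=\{(x_m,x_{m+1},\ldots,x_{n+1})\in\prod_{i=m}^{n+1}X_i\mid x_i\in F_i(x_{i+1})\text{ for all } i\in\{m,\ldots,n\}\}$, with the subspace topology of the product. Diameters in finite products are taken with respect to the sup-type product metric (any compatible metric gives the same condition). *)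

(* Defs.v *)
From HB Require Import structures.
From mathcomp Require Import all_boot all_order all_algebra.
From mathcomp Require Import all_classical all_reals all_analysis.
Import Order.TTheory GRing.Theory Num.Theory.
Import numFieldNormedType.Exports.

Set Implicit Arguments.
Unset Strict Implicit.
Unset Printing Implicit Defensive.

Local Open Scope classical_set_scope.
Local Open Scope ring_scope.

Definition fixed_point_property (T : topologicalType) : Prop :=
  forall f : T -> T, continuous f -> exists x, f x = x.

(* F takes its values in the hyperspace 2^Y of nonempty closed subsets of Y. *)
Definition set_valued (X Y : topologicalType) (F : X -> set Y) : Prop :=
  forall x, F x !=set0 /\ closed (F x).

Definition upper_semicontinuous (X Y : topologicalType) (F : X -> set Y) :
    Prop :=
  set_valued F /\ forall V : set Y, open V -> open [set x | F x `<=` V].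

(* The sequence of spaces is indexed from 0: X l and F l stand for X_{l+1} and
   F_{l+1}.  The subsets below become topological spaces through [set_type],
   which carries the subspace topology. *)
Section InverseSequence.
Context (R : realType) (X : nat -> metricType R).
Variable F : forall l, X l.+1 -> set (X l).

Definition inverse_limit : set (prod_topology (fun l : nat => X l)) :=
  [set x | forall l, @F l (x l.+1) (x l)].

(* The Mahavier product of the first n bonding functions, whose points have
   n + 1 coordinates. *)
Definition mahavier (n : nat) :
    set (prod_topology (fun i : 'I_n.+1 => X i)) :=
  [set x | forall i (h : (i.+1 < n.+1)%N),
     @F i (x (Ordinal h)) (x (Ordinal (ltnW h)))].

Arguments mahavier : clear implicits.

Lemma mahavier_trunc_subproof n (x : set_type (mahavier n.+1)) :
  mahavier n (fun i : 'I_n.+1 => set_val x (widen_ord (leqnSn n.+1) i)).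
Proof.
move=> i h; have := set_valP x i (leqW h); rewrite /widen_ord.
rewrite (bool_irrelevance (ltnW (leqW h))
  (widen_ord_proof (Ordinal (ltnW h)) (leqnSn n.+1))).
by rewrite (bool_irrelevance (leqW h)
  (widen_ord_proof (Ordinal h) (leqnSn n.+1))).
Qed.

Definition mahavier_trunc n (x : set_type (mahavier n.+1)) :
    set_type (mahavier n) :=
  SigSub (mem_set (mahavier_trunc_subproof x)).

Lemma limit_trunc_subproof n (x : set_type inverse_limit) :
  mahavier n (fun i : 'I_n.+1 => set_val x i).
Proof. by move=> i h; exact: (set_valP x i). Qed.

Definition limit_trunc n (x : set_type inverse_limit) :
    set_type (mahavier n) :=
  SigSub (mem_set (@limit_trunc_subproof n x)).

Arguments limit_trunc : clear implicits.

Definition mahavier_dist n (x y : set_type (mahavier n)) : R :=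
  \big[Order.max/0]_(i < n.+1) mdist (set_val x i) (set_val y i).

Definition diam n (A : set (set_type (mahavier n))) : \bar R :=
  ereal_sup [set e | exists x y, [/\ A x, A y & e = (mahavier_dist x y)%:E]].

(* H l stands for H_{l+1}. *)
Variable H : forall l, set_type (mahavier l.+2) -> set (set_type (mahavier l.+1)).

(* The points that agree with some value of H k at (x_0, .., x_{k+2}) in all
   coordinates common to both.  For j < k, the only case of interest, these are
   all the coordinates 0, .., j + 1; the definition is total in k so that k can
   tend to infinity. *)
Definition limit_section (j k : nat) (x : set_type inverse_limit) :
    set (set_type (mahavier j.+1)) :=
  [set z | exists2 y, @H k (limit_trunc k.+2 x) y &
     forall i (hj : (i < j.+2)%N) (hk : (i < k.+2)%N),
       set_val y (Ordinal hk) = set_val z (Ordinal hj)].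

End InverseSequence.

Arguments inverse_limit {R X} F.
Arguments mahavier {R X} F n.
Arguments limit_trunc {R X F} n x.
Arguments limit_section {R X F} H j k x.

(* Main.v *)
Require Import Defs.
From HB Require Import structures.
From mathcomp Require Import all_boot all_order all_algebra.
From mathcomp Require Import all_classical all_reals all_analysis.
Import Order.TTheory GRing.Theory Num.Theory.
Import numFieldNormedType.Exports.

(** Let [L] be the limit and [M n] the Mahavier products.

    From [H] to a fixed point free map: by compactness and (a), every [x : L]
    has a point [f x : L] all of whose prefixes lie in the values of [H] at the
    prefixes of [x]; it is unique by (b), and semicontinuity together with (b)
    makes each coordinate of [f] continuous.  A fixed point of [f] would
    contradict (c).

    From a fixed point free [f] to [H]: a point [x] of [M (k + 2)] need not
    extend to a point of [L], because the bonding functions need not be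
    surjective, so [H k x] cannot be taken to be the set of prefixes of the
    values of [f] at the extensions of [x].  Instead [y : L] is admitted when it
    agrees with [x] on the coordinates [0, .., m] up to [1 / (m + 1)], for every
    [m <= k] such that each point of [M (k + 2)] has an approximation of that
    quality.  These relations are closed and shrink with [k], and by compactness
    every [m] eventually qualifies, which gives (b) and (c).  If [L] is empty,
    some [M n] is empty and constant full values will do. *)

Set Implicit Arguments.
Unset Strict Implicit.
Unset Printing Implicit Defensive.

Local Open Scope classical_set_scope.
Local Open Scope ring_scope.

(** * Compactness, closed relations and upper semicontinuity in general spaces *)

Section Topology.

Lemma continuous_prod_topology (T : topologicalType) (I : Type)
    (K : I -> topologicalType) (g : T -> prod_topology K) :
  (forall i, continuous (fun t => g t i)) -> continuous g.
Proof.
move=> cg t; apply/cvg_sup => i U [_ [[B oB <-] Bgt BU]].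
have gB : nbhs t (fun s => B (g s i)) by exact/(cg i)/open_nbhs_nbhs.
by apply: filterS gB => s /BU.
Qed.

Lemma continuous_coord (I : eqType) (K : I -> topologicalType) (i : I) :
  continuous (fun x : prod_topology K => x i).
Proof. exact: (@proj_continuous I K i). Qed.

Lemma continuous_set_val (T : topologicalType) (A : set T) :
  continuous (set_val : set_type A -> T).
Proof. exact: initial_continuous. Qed.

Lemma continuous_set_type (S T : topologicalType) (A : set T)
    (g : S -> set_type A) :
  continuous (fun s => set_val (g s)) -> continuous g.
Proof.
move=> cg s U [_ [[B oB <-] Bgs BU]].
have gB : nbhs s (fun r => B (set_val (g r))) by exact/cg/open_nbhs_nbhs.
by apply: filterS gB => r /BU.
Qed.

Lemma hausdorff_set_type (T : topologicalType) (A : set T) :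
  hausdorff_space T -> hausdorff_space (set_type A).
Proof.
move=> hT p q pq; apply: val_inj; apply: hT => U V pU qV.
have [r [Ur Vr]] := pq _ _ (continuous_set_val pU) (continuous_set_val qV).
by exists (set_val r).
Qed.

Lemma compact_set_type (T : topologicalType) (A : set T) :
  compact A -> compact [set: set_type A].
Proof.
move=> cA G PG _.
have [|x [Ax clx]] := cA (set_val @ G) _.
  by apply: (@filterS _ G _ setT) => [y _|]; [exact: set_valP|exact: filterT].
exists (SigSub (mem_set Ax)); split => // U V GU [_ [[B oB <-] Bx BV]].
have GU' : G (set_val @^-1` (set_val @` U)).
  by apply: (@filterS _ G _ U) => // y Uy; exists y.
have [|_ [[y Uy <-] By]] := clx _ B GU'; first exact: open_nbhs_nbhs.
by exists y; split => //; exact: BV.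
Qed.

(** Near-covering compactness for [D n x -> U x]: a point of [U] has the neighbourhood [U], and a
    point outside [U] is missed by some closed [D n], hence locally by all later ones. *)
Lemma compact_decreasing_subset (T : topologicalType) (D : nat -> set T)
    (U : set T) :
  compact [set: T] -> (forall n, closed (D n)) ->
  (forall m n, (m <= n)%N -> D n `<=` D m) -> open U ->
  \bigcap_n D n `<=` U -> exists n, D n `<=` U.
Proof.
move=> /compact_near_coveringP cT cD dD oU DU.
have := cT nat \oo (fun n x => D n x -> U x) _; case.
  move=> x _; have [Ux|nUx] := pselect (U x).
    exists (U, setT) => /=.
      by split; [exact: open_nbhs_nbhs|exact: filterT].
    by move=> [y n] /= [].
  have [n nDn] : exists n, ~ D n x by apply/existsNP => Dx; exact/nUx/DU.
  exists (~` D n, [set m | (n <= m)%N]) => /=.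
    split; last by exists n.
    by apply: open_nbhs_nbhs; split => //; exact: closed_openC.
  by move=> [y m] /= [nDy nm] /(dD _ _ nm).
by move=> n _ /(_ n (leqnn n)) DnU; exists n => x; exact: DnU.
Qed.

Lemma compact_decreasing_nonempty (T : topologicalType) (D : nat -> set T) :
  compact [set: T] -> (forall n, closed (D n)) ->
  (forall m n, (m <= n)%N -> D n `<=` D m) -> (forall n, D n !=set0) ->
  \bigcap_n D n !=set0.
Proof.
move=> cT cD dD D0; apply: contrapT => nI.
have [|n Dn0] := compact_decreasing_subset cT cD dD open0.
  by move=> x Dx; apply: nI; exists x.
by have [x /Dn0] := D0 n.
Qed.

Lemma closed_mdist_le (R : realType) (T : topologicalType) (Y : metricType R)
    (f g : T -> Y) (c : R) :
  continuous f -> continuous g -> closed [set t | mdist (f t) (g t) <= c].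
Proof.
move=> cf cg t clt; rewrite /=; apply/ler_addgt0Pl => e e0.
have e2 : 0 < e / 2 by rewrite divr_gt0.
have ft : nbhs t (f @^-1` ball (f t) (e / 2)) by exact/cf/nbhsx_ballx.
have gt : nbhs t (g @^-1` ball (g t) (e / 2)) by exact/cg/nbhsx_ballx.
have [s [/= fgs []]] := clt _ (filterI ft gt).
rewrite /= !ballEmdist /= => fs gs.
apply: (le_trans (metric_triangle _ (f s) _)).
apply: (le_trans (lerD (ltW fs) (metric_triangle _ (g s) _))).
rewrite addrCA [leRHS]addrC; apply: (lerD fgs).
by rewrite [leRHS]splitr lerD2l metric_sym ltW.
Qed.

(** If [h s] is outside the closed set [F (g s)], regularity of [Y] gives a neighbourhood of [h s]
    whose closure misses that set; semicontinuity keeps [F (g r)] off this closure for [r] near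
    [s]. *)
Lemma usc_closed_graph (S : topologicalType) (X : topologicalType)
    (Y : uniformType) (F : X -> set Y) (g : S -> X) (h : S -> Y) :
  upper_semicontinuous F -> continuous g -> continuous h ->
  closed [set s | F (g s) (h s)].
Proof.
move=> [svF uF] cg ch s cls; apply: contrapT => nFs.
have oFC : open (~` F (g s)) by apply: closed_openC; exact: (svF _).2.
have [B hB clB] : filter_from (nbhs (h s)) closure (~` F (g s)).
  by apply: uniform_regular; exact: open_nbhs_nbhs.
have oBC : open (~` closure B) by apply: closed_openC; exact: closed_closure.
have gV : nbhs s (g @^-1` [set x | F x `<=` ~` closure B]).
  apply: cg; apply: open_nbhs_nbhs; split; first exact: uF.
  by move=> y Fy /clB.
have [r [/= Fr [FB Br]]] := cls _ (filterI gV (ch _ _ hB)).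
by apply: (FB _ Fr); exact: subset_closure.
Qed.

(** A tube argument: locally in [z] and near [x], either [g] stays in [V] or the closed [C] is
    avoided; compactness of [Z] makes one neighbourhood of [x] serve all [z]. *)
Lemma usc_image_closed_relation (X Y Z : topologicalType) (C : set (X * Z))
    (g : Z -> Y) :
  hausdorff_space Y -> compact [set: Z] -> closed C -> continuous g ->
  (forall x, exists z, C (x, z)) ->
  upper_semicontinuous (fun x => [set g z | z in [set z | C (x, z)]]).
Proof.
move=> hY cZ clC cg C0; split=> [x|V oV].
  split; first by have [z Cz] := C0 x; exists (g z), z.
  apply: compact_closed => //; apply: continuous_compact.
    by apply: continuous_subspaceT.
  apply: (subclosed_compact _ cZ) => //.
  apply: (preimage_closed _ clC) => z _.
  by apply: cvg_pair; [exact: cvg_cst|exact: cvg_id].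
rewrite openE => x /= gV.
have cover z : [set: Z] z ->
    \forall z' \near z & x' \near x, C (x', z') -> V (g z').
  move=> _; have [Cz|nCz] := pselect (C (x, z)).
    exists (g @^-1` V, setT) => /=; last by move=> [z' x'] /= [].
    split; last exact: filterT.
    by apply/cg/open_nbhs_nbhs; split => //; apply: gV; exists z.
  have : nbhs (x, z) (~` C).
    by apply: open_nbhs_nbhs; split => //; exact: closed_openC.
  move=> [[P Q] /= [xP zQ] PQ]; exists (Q, P) => //= -[z' x'] /= [Qz' Px'].
  by have /= := PQ (x', z') (conj Px' Qz').
move/compact_near_coveringP: cZ =>
  /(_ _ _ (fun x' z' => C (x', z') -> V (g z')) _ cover).
by apply: filterS => x' CV _ [z Cz <-]; exact: CV.
Qed.

Lemma compact_prod_topology (I : eqType) (K : I -> topologicalType) :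
  (forall i, compact [set: K i]) -> compact [set: prod_topology K].
Proof.
move=> cK; have := @tychonoff I K (fun i => [set: K i]) cK.
by congr compact; apply/seteqP.
Qed.

End Topology.

(** * Inverse limits, Mahavier products and their approximation *)

Section InverseSystem.
Context (R : realType) (X : nat -> metricType R)
  (F : forall l, X l.+1 -> set (X l)).
Context (compactX : forall l, compact [set: X l])
  (uscF : forall l, upper_semicontinuous (@F l)).

Local Notation P := (prod_topology (fun l : nat => X l)).
Local Notation Q n := (prod_topology (fun i : 'I_n.+1 => X i)).
Local Notation L := (set_type (inverse_limit F)).
Local Notation M n := (set_type (mahavier F n)).

Lemma mahavier_truncE n (x : M n.+1) i (h : (i < n.+1)%N) (h' : (i < n.+2)%N) :
  set_val (mahavier_trunc x) (Ordinal h) = set_val x (Ordinal h').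
Proof.
by rewrite (bool_irrelevance h' (widen_ord_proof (Ordinal h) (leqnSn _))).
Qed.

Lemma mahavier_eq n (x y : M n) :
  (forall i (h : (i < n.+1)%N),
     set_val x (Ordinal h) = set_val y (Ordinal h)) -> x = y.
Proof.
by move=> xy; apply: val_inj; apply: functional_extensionality_dep => -[i h].
Qed.

Lemma limit_eq (x y : L) : (forall i, set_val x i = set_val y i) -> x = y.
Proof. by move=> xy; apply: val_inj; exact: functional_extensionality_dep. Qed.

Lemma mahavier_trunc_limit n (x : L) :
  mahavier_trunc (limit_trunc n.+1 x) = limit_trunc n x.
Proof.
by apply: mahavier_eq => i h; rewrite (mahavier_truncE _ _ (leqW h)).
Qed.

Lemma continuous_limit_coord i : continuous (fun x : L => set_val x i : X i).
Proof.
move=> x; apply: (@continuous_comp L P (X i) set_val (fun z => z i)).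
  exact: continuous_set_val.
exact: continuous_coord.
Qed.

Lemma continuous_mahavier_coord n (i : 'I_n.+1) :
  continuous (fun x : M n => set_val x i : X i).
Proof.
move=> x.
apply: (@continuous_comp _ (Q n) (X i)
  set_val (fun z => z i)).
  exact: continuous_set_val.
exact: continuous_coord.
Qed.

Lemma continuous_limit_trunc n : continuous (@limit_trunc R X F n).
Proof.
apply: continuous_set_type; apply: continuous_prod_topology => i.
exact: continuous_limit_coord.
Qed.

Lemma closed_step l :
  closed ([set z | @F l (z l.+1) (z l)] : set P).
Proof.
by apply: (@usc_closed_graph _ _ _ _ (fun z : P => z l.+1) (fun z : P => z l)
  (uscF l)); exact: continuous_coord.
Qed.

Lemma closed_inverse_limit : closed (inverse_limit F).
Proof.
rewrite (_ : inverse_limit F = \bigcap_l [set z | @F l (z l.+1) (z l)]).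
  by apply: closed_bigI => l _; exact: closed_step.
by apply/seteqP; split => [z Fz l _|z Fz l]; [exact: Fz|exact: Fz].
Qed.

Lemma compact_inverse_limit : compact [set: L].
Proof.
apply: compact_set_type; apply: subclosed_compact closed_inverse_limit _ _.
  exact: compact_prod_topology.
by [].
Qed.

Lemma closed_mahavier n : closed (mahavier F n).
Proof.
rewrite (_ : mahavier F n = \bigcap_i \bigcap_(h in [set: (i.+1 < n.+1)%N])
    [set x : Q n | @F i (x (Ordinal h)) (x (Ordinal (ltnW h)))]).
  apply: closed_bigI => i _; apply: closed_bigI => h _.
  apply: (@usc_closed_graph _ _ _ _
    (fun x : Q n => x (Ordinal h))
    (fun x : Q n => x (Ordinal (ltnW h)))
    (uscF i)); exact: continuous_coord.
by apply/seteqP; split => [z Fz i _ h _|z Fz i h]; exact: Fz.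
Qed.

Lemma compact_mahavier n : compact [set: M n].
Proof.
apply: compact_set_type; apply: subclosed_compact (@closed_mahavier n) _ _.
  by apply: compact_prod_topology => i; exact: compactX.
by [].
Qed.

Lemma hausdorff_mahavier n : hausdorff_space (M n).
Proof.
apply: hausdorff_set_type.
by apply: hausdorff_product => i; exact: metric_hausdorff.
Qed.

(** These sets decrease to the inverse limit inside the single compact space [P], whereas the
    Mahavier products live in different spaces. *)
Definition partial_limit n : set P :=
  [set z | forall l, (l < n)%N -> @F l (z l.+1) (z l)].

Lemma partial_limit_subset (U : set P) :
  open U -> inverse_limit F `<=` U -> exists n, partial_limit n `<=` U.
Proof.
move=> oU LU; apply: compact_decreasing_subset => //.
- exact: compact_prod_topology.
- move=> n.
  rewrite (_ : partial_limit n =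
      \bigcap_(l in [set l | (l < n)%N]) [set z | @F l (z l.+1) (z l)]).
    by apply: closed_bigI => l _; exact: closed_step.
  by apply/seteqP; split.
- by move=> m n mn z Fz l lm; apply: Fz; exact: leq_trans mn.
- by move=> z Fz; apply: LU => l; exact: (Fz l.+1 I l).
Qed.

(** [p] supplies fillers beyond coordinate [n], so that a point of [M n] lands in [partial_limit n]
    even when it extends to no point of [L]. *)
Definition extend n (p : P) (x : M n) : P := fun i =>
  if pselect (i < n.+1)%N is left h then set_val x (Ordinal h) else p i.

Lemma extendE n p (x : M n) i (h : (i < n.+1)%N) :
  extend p x i = set_val x (Ordinal h).
Proof.
by rewrite /extend; case: pselect => // h'; rewrite (bool_irrelevance h' h).
Qed.

Lemma partial_limit_extend n p (x : M n) : partial_limit n (extend p x).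
Proof.
move=> l ln; have h : (l.+1 < n.+1)%N by [].
by rewrite (extendE _ _ h) (extendE _ _ (ltnW h)); exact: (set_valP x l h).
Qed.

(** If every [M i] had a point, their last coordinates would form a filler [p], and extensions would
    make every [partial_limit n] nonempty, against compactness. *)
Lemma mahavier_empty : ~ ([set: L] !=set0) -> exists n, ~ ([set: M n] !=set0).
Proof.
move=> L0; apply: contrapT => /forallNP M0.
have p i : X i.
  have /cid[x _] : [set: M i] !=set0 by apply: contrapT; exact: M0.
  exact: (set_val x (@Ordinal i.+1 i (leqnn _))).
have [n Pn] : exists n, partial_limit n `<=` set0.
  apply: partial_limit_subset; first exact: open0.
  by move=> z Lz; apply: L0; exists (SigSub (mem_set Lz)).
by have /contrapT[x _] := M0 n; exact: (Pn _ (partial_limit_extend p x)).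
Qed.

(** One index [m] sets both the number of coordinates compared and the tolerance, so a larger [m] is
    a stronger condition. *)
Definition prefix_close m n (x : M n) (y : L) := forall i (h : (i < n.+1)%N),
  (i <= m)%N -> mdist (set_val x (Ordinal h)) (set_val y i) <= m.+1%:R^-1.

Definition limit_close m (x y : L) := forall i,
  (i <= m)%N -> mdist (set_val x i) (set_val y i) <= m.+1%:R^-1.

Lemma tolerance_le m n : (m <= n)%N -> n.+1%:R^-1 <= m.+1%:R^-1 :> R.
Proof. by move=> mn; rewrite lef_pV2 ?posrE ?ler_nat. Qed.

Lemma prefix_close_le m m' n (x : M n) y :
  (m <= m')%N -> prefix_close m' x y -> prefix_close m x y.
Proof.
move=> mm xy i h im.
by apply: le_trans (tolerance_le mm); apply: xy; exact: leq_trans mm.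
Qed.

Lemma limit_close_le m m' x y :
  (m <= m')%N -> limit_close m' x y -> limit_close m x y.
Proof.
move=> mm xy i im.
by apply: le_trans (tolerance_le mm); apply: xy; exact: leq_trans mm.
Qed.

Lemma prefix_close_trunc m n (x : M n.+1) y :
  prefix_close m x y -> prefix_close m (mahavier_trunc x) y.
Proof.
by move=> xy i h im; rewrite (mahavier_truncE _ _ (leqW h)); exact: xy.
Qed.

(** The closed sets of all [y] with [limit_close m (f y) (g y)] decrease to the equalizer of [f] and
    [g], so compactness puts one of them in [U]. *)
Lemma limit_close_open (f g : L -> L) (U : set L) :
  continuous f -> continuous g -> open U -> (forall y, f y = g y -> U y) ->
  exists m, forall y, limit_close m (f y) (g y) -> U y.
Proof.
move=> cf cg oU fgU.
apply: (compact_decreasing_subset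
  (D := fun m => [set y | limit_close m (f y) (g y)]) compact_inverse_limit) => //.
- move=> m; rewrite (_ : [set y | _] = \bigcap_(i in [set i | (i <= m)%N])
      [set y | mdist (set_val (f y) i) (set_val (g y) i) <= m.+1%:R^-1]).
    apply: closed_bigI => i _; apply: closed_mdist_le => y.
      exact: (@continuous_comp _ _ _ f _ y (cf y)
        (@continuous_limit_coord i _)).
    exact: (@continuous_comp _ _ _ g _ y (cg y) (@continuous_limit_coord i _)).
  by apply/seteqP; split.
- by move=> m n mn y; exact: limit_close_le.
move=> y fgy; apply: fgU; apply: limit_eq => i; apply: mdist_positivity.
apply/eqP; rewrite eq_le mdist_ge0 andbT; apply/ler_addgt0Pl => e e0.
have [n _ /(_ _ (leqnn n)) ne] := near_infty_natSinv_lt (PosNum e0).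
(* Level [maxn i n] is large enough to compare coordinate [i] and has tolerance below [e]. *)
rewrite addr0; apply: (le_trans (fgy (maxn i n) I i (leq_maxl _ _))).
by apply: (le_trans (tolerance_le (leq_maxr i n))); exact: ltW.
Qed.

(** The open boxes [V y m.+1] cover [L], hence some [partial_limit K], which contains the extensions
    of the points of [M n] for [K <= n]. *)
Lemma limit_approx m : [set: L] !=set0 ->
  exists K, forall n, (K <= n)%N ->
    forall x : M n, exists y, prefix_close m x y.
Proof.
move=> [p _].
pose V (y : L) n : set P :=
  [set z | forall i, (i < n)%N -> (ball (set_val y i) m.+1%:R^-1)^° (z i)].
have oV y n : open (V y n).
  elim: n => [|n IHn].
    by rewrite (_ : V y 0%N = setT) -?subTset //; exact: openT.
  rewrite (_ : V y n.+1 =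
      V y n `&` (fun z : P => z n) @^-1` (ball (set_val y n) m.+1%:R^-1)^°).
    apply: openI => //; apply: open_comp; last exact: open_interior.
    by move=> z _; exact: continuous_coord.
  apply/seteqP; split=> [z Vz|z [Vz zn] i].
    by split=> [i iN|]; apply: Vz => //; exact: ltnW.
  by rewrite ltnS leq_eqVlt => /predU1P[->//|]; exact: Vz.
have [K KV] : exists K, partial_limit K `<=` \bigcup_y V y m.+1.
  apply: partial_limit_subset; first exact: bigcup_open.
  move=> z Lz; exists (SigSub (mem_set Lz)) => // i _.
  by apply: nbhsx_ballx; rewrite invr_gt0.
exists K => n Kn x.
have [|y _ Vy] := KV (extend (set_val p) x).
  by move=> l lK; apply: partial_limit_extend; exact: leq_trans Kn.
exists y => i h im; have := interior_subset (Vy i im).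
by rewrite ballEmdist (extendE _ _ h) /= metric_sym => /ltW.
Qed.

Lemma mdist_lt_diam n (A : set (M n)) e x y i : (diam A < e%:E)%E ->
  A x -> A y -> mdist (set_val x i) (set_val y i) < e.
Proof.
move=> Ae Ax Ay; rewrite -lte_fin; apply: le_lt_trans Ae.
apply: (@le_trans _ _ (mahavier_dist x y)%:E).
  rewrite lee_fin.
  exact: (le_bigmax _ (fun i => mdist (set_val x i) (set_val y i))).
by apply: ereal_sup_ubound; exists x, y.
Qed.

(** Nonemptiness is asked because the diameter of the empty set is [-oo]. Eventual finiteness then
    reduces the claim to real limits. *)
Lemma cvg_diam0 n (A : nat -> set (M n)) :
  (forall e, 0 < e -> \forall k \near \oo, A k !=set0 /\
     forall x y, A k x -> A k y ->
       forall i, mdist (set_val x i) (set_val y i) <= e) ->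
  diam (A k) @[k --> \oo] --> 0%E.
Proof.
move=> A0.
have dA e : 0 < e -> \forall k \near \oo, (0 <= diam (A k) <= e%:E)%E.
  move=> e0; apply: filterS (A0 e e0) => k [[x Ax] Ae]; apply/andP; split.
    apply: (@le_trans _ _ (mahavier_dist x x)%:E); last first.
      by apply: ereal_sup_ubound; exists x, x.
    by rewrite lee_fin; exact: bigmax_ge_id.
  apply: ge_ereal_sup => _ [y [z [Ay Az ->]]]; rewrite lee_fin.
  by apply: bigmax_le => [|i _]; [exact: ltW|exact: Ae].
have fA e k : (0 <= diam (A k) <= e%:E)%E -> diam (A k) \is a fin_num.
  by move=> /andP[d0 de]; rewrite ge0_fin_numE// (le_lt_trans de)// ltry.
apply/fine_cvgP; split.
  by apply: filterS (dA 1 ltr01) => k; exact: fA.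
apply/cvgrPdist_le => e e0; apply: filterS (dA e e0) => k dk.
have := dk; rewrite -(fineK (fA _ _ dk)) !lee_fin => /andP[d0 de].
by rewrite sub0r normrN ger0_norm.
Qed.

End InverseSystem.

(** * The functions [H] built from a self-map of the limit *)

Section ApproxImage.
Context (R : realType) (X : nat -> metricType R)
  (F : forall l, X l.+1 -> set (X l)).
Context (compactX : forall l, compact [set: X l])
  (uscF : forall l, upper_semicontinuous (@F l)).

Local Notation L := (set_type (inverse_limit F)).
Local Notation M n := (set_type (mahavier F n)).

(** Quantifying over all of [M k.+2] makes the constraints in [approx_relation] independent of the
    point, which keeps that relation closed. *)
Definition approximable k m := forall x : M k.+2, exists y, prefix_close m x y.

Definition approx_relation k : set (M k.+2 * L) :=
  [set p | forall m, (m <= k)%N -> approximable k m -> prefix_close m p.1 p.2].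

Definition approx_image (f : L -> L) k (x : M k.+2) : set (M k.+1) :=
  [set limit_trunc k.+1 (f y) | y in [set y | approx_relation (x, y)]].

Lemma closed_approx_relation k : closed (@approx_relation k).
Proof.
rewrite (_ : @approx_relation k =
  \bigcap_(m in [set m | (m <= k)%N /\ approximable k m])
  \bigcap_(i in [set: nat]) \bigcap_(h in [set h : (i < k.+3)%N | (i <= m)%N])
    [set p : M k.+2 * L |
      mdist (set_val p.1 (Ordinal h)) (set_val p.2 i) <= m.+1%:R^-1]).
  apply: closed_bigI => m _; apply: closed_bigI => i _.
  apply: closed_bigI => h _.
  apply: closed_mdist_le => p.
    apply: (@continuous_comp _ _ _ fst
      (fun x : M k.+2 => set_val x (Ordinal h))).
      exact: cvg_fst.
    exact: continuous_mahavier_coord.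
  apply: (@continuous_comp _ _ _ snd (fun y : L => set_val y i)).
    exact: cvg_snd.
  exact: continuous_limit_coord.
apply/seteqP; split => [p pC m [mk km] i _ h im|p pC m mk km i h im].
  exact: pC.
exact: (pC m (conj mk km) i I h im).
Qed.

(** A [y] that serves the largest approximable [m <= k] serves all smaller ones; if there is no such
    [m], any point of [L] will do. *)
Lemma approx_relation_nonempty k (x : M k.+2) :
  [set: L] !=set0 -> exists y, approx_relation (x, y).
Proof.
move=> [p _].
suff /(_ k.+1)[y xy] j : exists y, forall m, (m < j)%N ->
  approximable k m -> prefix_close m x y by exists y.
elim: j => [|j [y xy]]; first by exists p.
have [/(_ x)[z xz]|nj] := pselect (approximable k j).
  by exists z => m; rewrite ltnS => mj _; exact: prefix_close_le xz.
exists y => m; rewrite ltnS leq_eqVlt => /predU1P[->//|]; exact: xy.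
Qed.

Lemma approx_image_usc f k : [set: L] !=set0 -> continuous f ->
  upper_semicontinuous (@approx_image f k).
Proof.
move=> L0 cf; apply: usc_image_closed_relation.
- exact: hausdorff_mahavier.
- exact: compact_inverse_limit.
- exact: closed_approx_relation.
- move=> y; apply: (@continuous_comp _ _ _ f (@limit_trunc R X F k.+1)).
    exact: cf.
  exact: continuous_limit_trunc.
- by move=> x; exact: approx_relation_nonempty.
Qed.

(** An [m <= k] approximable at [k] is so at [k.+1], since truncation keeps the compared coordinates
    [i <= m]. Hence the relation at [k.+1] imposes all the constraints of the one at [k]. *)
Lemma approx_image_trunc f k (x : M k.+3) (z : M k.+2) :
  approx_image f x z -> approx_image f (mahavier_trunc x) (mahavier_trunc z).
Proof.
move=> [y xy <-]; exists y; last by rewrite mahavier_trunc_limit.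
move=> m mk km /=; apply: prefix_close_trunc; apply: xy; first exact: leqW.
move=> x'; have [w x'w] := km (mahavier_trunc x'); exists w => i h im.
have h' : (i < k.+3)%N by rewrite ltnS (leq_trans im)// (leq_trans mk)// ltnW.
by rewrite -(mahavier_truncE _ h'); exact: x'w.
Qed.

Lemma approx_image_close f m : [set: L] !=set0 ->
  exists K, forall k, (K <= k)%N ->
  forall x z, @approx_image f k x z ->
    exists y, [/\ prefix_close m x y, (m <= k)%N & z = limit_trunc k.+1 (f y)].
Proof.
move=> L0; have [K Kclose] := limit_approx compactX uscF m L0.
exists (maxn m K) => k; rewrite geq_max => /andP[mk Kk] x z [y xy <-].
exists y; split=> //; apply: xy => // x'.
by apply: Kclose; rewrite (leq_trans Kk)// ltnW// ltnW.
Qed.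

(** For large [k] the section consists of prefixes of [f w] with [w] close to [x]; continuity at [x]
    puts them within [e / 2] of [f x], hence within [e] of each other. *)
Lemma approx_image_diam f j (x : L) : continuous f ->
  diam (limit_section (@approx_image f) j k x) @[k --> \oo] --> 0%E.
Proof.
move=> cf; have L0 : [set: L] !=set0 by exists x.
apply: cvg_diam0 => e e0.
have e2 : 0 < e / 2 by rewrite divr_gt0.
pose U : set L := [set y | forall i : 'I_j.+2,
  mdist (set_val (f x) i) (set_val (f y) i) <= e / 2].
have Ux : U^° x.
  apply: (@filter_forall L 'I_j.+2 (fun i y =>
    mdist (set_val (f x) i) (set_val (f y) i) <= e / 2) (nbhs x)) => i.
  have cfi : {for x, continuous (fun y => set_val (f y) i : X i)}.
    exact: (@continuous_comp _ _ _ f _ x (cf x)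
      (@continuous_limit_coord _ _ _ i _)).
  have : nbhs x [set y | ball (set_val (f x) i) (e / 2) (set_val (f y) i)].
    exact/cfi/nbhsx_ballx.
  by apply: filterS => y /=; rewrite ballEmdist => /ltW.
(* Taking [f] constant and [g] the identity in [limit_close_open] shows that closeness to [x] at
   some level forces membership in a given neighbourhood. *)
have [m xU] : exists m, forall y, limit_close m x y -> U^° y.
  apply: (limit_close_open compactX uscF (f := fun=> x) (g := id)
    (U := U^°)) => //.
  - by move=> y; exact: cst_continuous.
  - by move=> y; exact: cvg_id.
  - exact: open_interior.
  - by move=> y <-.
have [K HK] := approx_image_close f m L0.
exists (maxn j K) => // k /=; rewrite geq_max => /andP[jk Kk].
have close_fx z : limit_section (@approx_image f) j k x z ->
    forall i, mdist (set_val (f x) (nat_of_ord i)) (set_val z i) <= e / 2.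
  move=> [y /(HK _ Kk)[w [xw mk ->]] wz] [i ij].
  have ik : (i < k.+2)%N by rewrite (leq_trans ij).
  rewrite -(wz i ij ik) /=; have Uw := interior_subset (xU w _).
  apply: (Uw _ (Ordinal ij)) => l lm.
  have lk : (l < k.+3)%N by rewrite ltnS (leq_trans lm)// (leq_trans mk)// ltnW.
  exact: (xw l lk lm).
split=> [|z z' /close_fx xz /close_fx xz' i].
  have [y xy] := approx_relation_nonempty (limit_trunc k.+2 x) L0.
  exists (limit_trunc j.+1 (f y)), (limit_trunc k.+1 (f y)) => //.
  by exists y.
apply: (le_trans (metric_triangle _ (set_val (f x) i) _)).
by rewrite (splitr e) lerD// metric_sym.
Qed.

(** By compactness some [m] admits no [y] with [limit_close m (f y) y]. A violating [x] would agree
    with [f y] and be close to [y] on the coordinates up to [m]. *)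
Lemma approx_image_fixed_point_free f : [set: L] !=set0 -> continuous f ->
  (forall x, f x <> x) ->
  exists k, forall x : M k.+2, ~ approx_image f x (mahavier_trunc x).
Proof.
move=> L0 cf nf.
have [m fm] : exists m, forall y, limit_close m (f y) y -> set0 y.
  apply: (limit_close_open compactX uscF (f := f) (g := id) (U := set0)) => //.
  - by move=> y; exact: cvg_id.
  - exact: open0.
have [K HK] := approx_image_close f m L0; exists K => x.
move=> /(HK K (leqnn K))[y [xy mK xfy]]; apply: (fm y) => i im.
have iK : (i < K.+2)%N by rewrite ltnS (leq_trans im)// (leq_trans mK).
have := xy i (leqW iK) im.
by rewrite -(mahavier_truncE _ iK) xfy.
Qed.

End ApproxImage.

(** * The continuous self-map of the limit obtained from the functions [H] *)

Section Selection.
Context (R : realType) (X : nat -> metricType R)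
  (F : forall l, X l.+1 -> set (X l)).
Context (compactX : forall l, compact [set: X l])
  (uscF : forall l, upper_semicontinuous (@F l)).

Local Notation P := (prod_topology (fun l : nat => X l)).
Local Notation Q n := (prod_topology (fun i : 'I_n.+1 => X i)).
Local Notation L := (set_type (inverse_limit F)).
Local Notation M n := (set_type (mahavier F n)).

Context (H : forall l, M l.+2 -> set (M l.+1)).
Context (uscH : forall l, upper_semicontinuous (@H l)).
Context (truncH : forall k (x : M k.+3) (z : M k.+2),
  H x z -> H (mahavier_trunc x) (mahavier_trunc z)).
Context (diamH : forall j (x : L),
  diam (limit_section H j k x) @[k --> \oo] --> 0%E).

Definition follows (x z : L) :=
  forall k, H (limit_trunc k.+2 x) (limit_trunc k.+1 z).

(** The sets [B k] are cylinders in the compact space [P], nested by [truncH]; a point common to all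
    of them is the required [z]. *)
Lemma follows_exists x : exists z, follows x z.
Proof.
pose r k (z : P) : Q k := fun i => z i.
pose B k := r k.+1 @^-1` (set_val @` H (limit_trunc k.+2 x)).
have [|k|m n mn|k|z Bz] := @compact_decreasing_nonempty P B.
- exact: compact_prod_topology.
- apply: preimage_closed => [z _|].
    by apply: continuous_prod_topology => i; exact: continuous_coord.
  apply: compact_closed.
    by apply: hausdorff_product => i; exact: metric_hausdorff.
  apply: (@continuous_compact (M k.+1) (Q k.+1) set_val).
    by apply: continuous_subspaceT; exact: continuous_set_val.
  apply: subclosed_compact (compact_mahavier compactX uscF (n := k.+1)) _ => //.
  exact: ((uscH k).1 _).2.
- elim: n mn => [|n IHn]; first by rewrite leqn0 => /eqP->.
  rewrite leq_eqVlt => /predU1P[->//|/IHn nm]; apply: subset_trans nm.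
  move=> z [y /truncH xy yz]; exists (mahavier_trunc y).
    by rewrite -mahavier_trunc_limit.
  apply: functional_extensionality_dep => -[i h].
  by rewrite (mahavier_truncE _ _ (leqW h)) yz.
- have [y xy] := ((uscH k).1 (limit_trunc k.+2 x)).1.
  exists (extend (set_val x) y), y => //.
  by apply: functional_extensionality_dep => -[i h]; rewrite /r (extendE _ _ h).
have Lz : inverse_limit F z.
  move=> l; have [y _ yz] := Bz l I.
  have zE i (h : (i < l.+2)%N) : z i = set_val y (Ordinal h) by rewrite yz.
  rewrite (zE _ (leqnn _)) (zE _ (ltnW (leqnn _))).
  exact: (set_valP y l).
exists (SigSub (mem_set Lz)) => k; have [y xy yz] := Bz k I.
rewrite (_ : limit_trunc _ _ = y) //.
by apply: mahavier_eq => i h; rewrite yz.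
Qed.

Lemma follows_section x z j k : (j <= k)%N -> follows x z ->
  limit_section H j k x (limit_trunc j.+1 z).
Proof. by move=> jk /(_ k) xz; exists (limit_trunc k.+1 z). Qed.

Lemma diam_small j x e : 0 < e ->
  exists2 k, (j <= k)%N & (diam (limit_section H j k x) < e%:E)%E.
Proof.
move=> e0; have nb : nbhs 0%E [set d : \bar R | (d < e%:E)%E].
  by apply: open_ereal_lt'; rewrite lte_fin.
have [K _ HK] : \forall k \near \oo,
  (diam (limit_section H j k x) < e%:E)%E.
  exact: (diamH j x nb).
exists (maxn j K); first exact: leq_maxl.
by apply: HK => /=; exact: leq_maxr.
Qed.

Lemma follows_unique x z z' : follows x z -> follows x z' -> z = z'.
Proof.
move=> xz xz'; apply: limit_eq => i; apply: mdist_positivity.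
apply/eqP; rewrite eq_le mdist_ge0 andbT; apply/ler_addgt0Pl => e e0.
have [k ik de] := diam_small i x e0; rewrite addr0 ltW//.
have h : (i < i.+2)%N by exact: leqW.
exact: (mdist_lt_diam (Ordinal h) de (follows_section ik xz)
  (follows_section ik xz')).
Qed.

Lemma mahavier_prefix j n (y : M n) : (j <= n)%N ->
  exists z : M j, forall i (hj : (i < j.+1)%N) (hn : (i < n.+1)%N),
    set_val y (Ordinal hn) = set_val z (Ordinal hj).
Proof.
elim: n y => [|n IHn] y; rewrite leq_eqVlt => /predU1P[jn|//]; subst.
- by exists y => i hj hn; rewrite (bool_irrelevance hj hn).
- by exists y => i hj hn; rewrite (bool_irrelevance hj hn).
rewrite ltnS => jn; have [z yz] := IHn (mahavier_trunc y) jn.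
exists z => i hj hn; have hn' := leq_trans hj (jn : (j.+1 <= n.+1)%N).
by rewrite -(yz i hj hn') (mahavier_truncE _ _ hn).
Qed.

Lemma follows_continuous f : (forall x, follows x (f x)) -> continuous f.
Proof.
move=> xf.
suff cf i : continuous (fun x : L => set_val (f x) i : X i).
  by apply: continuous_set_type; exact: continuous_prod_topology.
move=> x U /nbhs_ballP[e /= e0 eU].
have e2 : 0 < e / 2 by rewrite divr_gt0.
have [k ik de] := diam_small i x e2.
have ih : (i < i.+2)%N by exact: leqW.
have kh : (i < k.+2)%N by rewrite ltnW// ltnS.
pose V : set (M k.+1) :=
  [set y : M k.+1 | (ball (set_val (f x) i) e)^° (set_val y (Ordinal kh))].
have oV : open V.
  apply: open_comp (open_interior _) => y _.
  exact: continuous_mahavier_coord.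
have HV : H (limit_trunc k.+2 x) `<=` V.
  move=> y xy; have [z yz] := mahavier_prefix y (ik : (i.+1 <= k.+1)%N).
  have xz : limit_section H i k x z by exists y => // l hj hk; exact: yz.
  have := mdist_lt_diam (Ordinal ih) de (follows_section ik (xf x)) xz.
  rewrite -(yz i ih kh) /= => fy; apply: filterS (nbhsx_ballx _ _ e2) => w yw.
  by apply: ball_split yw; rewrite ballEmdist.
have : nbhs x (@limit_trunc R X F k.+2 @^-1` [set x' | H x' `<=` V]).
  apply: continuous_limit_trunc; apply: open_nbhs_nbhs.
  by split; [exact: (uscH k).2|].
apply: filterS => x' /= x'V; apply: eU.
exact: interior_subset (x'V _ (xf x' k)).
Qed.

End Selection.

Theorem theorem5p4 (R : realType) (X : nat -> metricType R)
    (F : forall l, X l.+1 -> set (X l))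
    (compactX : forall l, compact [set: X l])
    (uscF : forall l, upper_semicontinuous (@F l)) :
  ~ fixed_point_property (set_type (inverse_limit F)) <->
  exists H : forall l, set_type (mahavier F l.+2) ->
                       set (set_type (mahavier F l.+1)),
    [/\ forall l, upper_semicontinuous (@H l),
        forall k (x : set_type (mahavier F k.+3))
               (z : set_type (mahavier F k.+2)),
          H k.+1 x z -> H k (mahavier_trunc x) (mahavier_trunc z),
        forall j (x : set_type (inverse_limit F)),
          diam (limit_section H j k x) @[k --> \oo] --> 0%E
      & exists k, forall x : set_type (mahavier F k.+2),
          ~ H k x (mahavier_trunc x)].
Proof.
split=> [nfpp|[H [uscH truncH diamH [k Hk]]] fpp]; last first.
  have /choice[f xf] := follows_exists compactX uscF uscH truncH.
  have [x fx] := fpp f (follows_continuous uscH diamH xf).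
  apply: (Hk (limit_trunc k.+2 x)); rewrite mahavier_trunc_limit.
  by have := xf x k; rewrite fx.
have [L0|L0] := pselect ([set: set_type (inverse_limit F)] !=set0).
  have [f [cf nf]] : exists f : set_type (inverse_limit F) -> _,
      continuous f /\ forall x, f x <> x.
    move: nfpp => /existsNP[f /not_implyP[cf nf]].
    by exists f; split => // x fx; apply: nf; exists x.
  exists (@approx_image R X F f); split.
  - by move=> l; exact: approx_image_usc.
  - by move=> k x z; exact: approx_image_trunc.
  - by move=> j x; exact: approx_image_diam.
  - exact: approx_image_fixed_point_free.
have [n Mn] := mahavier_empty compactX uscF L0.
exists (fun l _ => setT); split.
- move=> l; split=> [x|V oV].
    split; last exact: closedT.
    by exists (mahavier_trunc x).
  have [VT|VT] := pselect ([set: set_type (mahavier F l.+1)] `<=` V).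
    rewrite (_ : [set _ | _] = setT); first exact: openT.
    by apply/seteqP; split.
  rewrite (_ : [set _ | _] = set0); first exact: open0.
  by apply/seteqP; split.
- by [].
- by move=> j x; case: L0; exists x.
exists n => x _; apply: Mn.
by exists (mahavier_trunc (mahavier_trunc x)).
Qed.
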